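(* Let $k\ge 2$ be a fixed integer. For each positive integer $n$, place $n^{k-1}$ line-rooks at random on the $k$-dimensional chessboard with side length $n$. Then, as $n\to\infty$, the expected proportion of safe spaces converges to $1/e^k$.
   Context: The $k$-dimensional board of side length $n$ is the set of spaces $\{1,\dots,n\}^k$. ''Placing $n^{k-1}$ pieces at random'' means that the set of occupied spaces (the board configuration) is chosen uniformly among all $\binom{n^k}{n^{k-1}}$ subsets of $n^{k-1}$ distinct spaces. A line-rook attacks every space that agrees with its position in all but one coordinate. A space is safe under a board configuration if it is neither occupied nor attacked by any of the placed pieces. The expected proportion of safe spaces is the expected number of safe spaces divided by $n^k$. *)

(* Defs.v *)
From HB Require Import structures.
From mathcomp Require Import all_boot all_order all_algebra.
From mathcomp Require Import reals.

Set Implicit Arguments.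
Unset Strict Implicit.
Unset Printing Implicit Defensive.

Import Order.TTheory GRing.Theory Num.Theory.
Local Open Scope ring_scope.

(* Coordinates range over 0, ..., n - 1 instead of 1, ..., n. *)
Definition space (k n : nat) : finType := {ffun 'I_k -> 'I_n}.

Definition attacks (k n : nat) (x y : space k n) : bool :=
  #|[set i : 'I_k | x i != y i]| == 1%N.

Definition boards (k n : nat) : {set {set space k n}} :=
  [set B : {set space k n} | #|B| == (n ^ (k - 1))%N].

Definition safe_spaces (k n : nat) (B : {set space k n}) : {set space k n} :=
  [set y : space k n | (y \notin B) && [forall x in B, ~~ attacks x y]].

(* Expectation of f under the uniform probability on the finite set A. *)
Definition uniform_expectation (R : realType) (T : finType) (A : {set T})
    (f : T -> R) : R :=
  (\sum_(x in A) f x) / #|A|%:R.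

(* For n = 0 and k > 0 the division is by 0 and the value is 0. *)
Definition expected_safe_proportion (R : realType) (k n : nat) : R :=
  uniform_expectation (boards k n) (fun B => #|safe_spaces B|%:R)
    / (n ^ k)%N%:R.

(* Main.v *)
Require Import Defs.
From HB Require Import structures.
From mathcomp Require Import all_boot all_order all_algebra.
From mathcomp Require Import all_classical all_reals all_analysis.
From mathcomp Require Import ring zify.
Import Order.TTheory GRing.Theory Num.Theory.
Import numFieldNormedType.Exports.
Local Open Scope ring_scope.

(** By linearity of expectation and symmetry, the expected proportion is the
    probability that one space [y] is safe, that is ['C(n^k - a, m) / 'C(n^k, m)]
    with [m = n^(k-1)] rooks and [a = 1 + k(n-1)] spaces equal to or attacking
    [y]. Written as a product of [m] factors [1 - a / (n^k - i)], this ratio lies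
    between [exp (- a m / (n^k - a - m))] and [exp (- a m / n^k)], and both
    exponents tend to [-k]. *)

Definition deadly_spaces {k n : nat} (y : Defs.space k n) : {set Defs.space k n} :=
  [set x | (x == y) || attacks x y].

(** An attacker of [y] is determined by the one coordinate [i] where it differs and its value
    [v != y i] there. So [move_to] is a bijection from such pairs onto the attackers, and each of
    the [k] directions contributes [n.-1] of them. *)
Lemma card_attackers (k n : nat) (y : Defs.space k n) :
  #|[set x | attacks x y]| = (k * n.-1)%N.
Proof.
pose P := [set p : 'I_k * 'I_n | p.2 != y p.1].
pose move_to (p : 'I_k * 'I_n) : Defs.space k n :=
  [ffun i => if i == p.1 then p.2 else y i].
have diff_move p : p \in P -> [set i | move_to p i != y i] = [set p.1].
  rewrite inE => yp; apply/setP => i; rewrite !inE ffunE.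
  by have [->|_] := eqVneq i p.1; rewrite ?eqxx.
have -> : [set x | attacks x y] = move_to @: P.
  apply/setP => x; rewrite inE; apply/idP/imsetP => [/cards1P[i xi]|[p Pp ->]].
    exists (i, x i); first by have := set11 i; rewrite -xi !inE.
    apply/ffunP => j; rewrite ffunE /=; have [->//|ji] := eqVneq j i.
    have : j \notin [set i] by rewrite inE.
    by rewrite -xi inE negbK => /eqP.
  by rewrite /attacks diff_move // cards1.
rewrite card_in_imset => [|p q Pp Pq pq].
  rewrite -sum1_card (eq_bigl (fun p : 'I_k * 'I_n => p.2 != y p.1)); last first.
    by move=> p; rewrite inE.
  rewrite -(pair_big_dep xpredT (fun i v => v != y i) (fun _ _ => 1%N)) /=.
  under eq_bigr => i _ do rewrite sum1_card (cardC1 (y i)) card_ord.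
  by rewrite sum_nat_const card_ord.
have p1q1 : p.1 = q.1.
  by apply: set1_inj; rewrite -!diff_move // pq.
have : move_to p p.1 = move_to q p.1 by rewrite pq.
by rewrite !ffunE eqxx p1q1 eqxx; case: p q p1q1 {Pp Pq pq} => [? ?] [? ?] /= -> ->.
Qed.

Lemma card_deadly_spaces (k n : nat) (y : Defs.space k n) :
  #|deadly_spaces y| = (k * n.-1).+1.
Proof.
have -> : deadly_spaces y = y |: [set x | attacks x y].
  by apply/setP => x; rewrite !inE.
rewrite cardsU1 card_attackers inE /attacks.
have -> : [set i | y i != y i] = finset.set0.
  by apply/setP => i; rewrite !inE eqxx.
by rewrite cards0.
Qed.

Lemma mem_safe_spaces (k n : nat) (B : {set Defs.space k n}) (y : Defs.space k n) :
  (y \in safe_spaces B) = (B \subset ~: deadly_spaces y).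
Proof.
rewrite inE; apply/andP/fintype.subsetP => [[yB /forallP safe] x xB|safe].
  rewrite !inE negb_or; move: (safe x); rewrite xB /= => ->.
  by rewrite andbT; apply: contraNneq yB => <-.
split; first by apply/negP => /safe; rewrite !inE eqxx.
by apply/forallP => x; apply/implyP => /safe; rewrite !inE negb_or => /andP[].
Qed.

(** Double counting: after the sums are exchanged, each [y] contributes the boards drawn from the
    complement of [deadly_spaces y], whose size does not depend on [y]. *)
Lemma sum_card_safe_spaces (k n : nat) :
  (\sum_(B in boards k n) #|safe_spaces B| =
   n ^ k * 'C(n ^ k - (k * n.-1).+1, n ^ (k - 1)))%N.
Proof.
under eq_bigr => B _ do rewrite -sum1_card big_mkcond.
rewrite exchange_big /=.
rewrite (eq_bigr (fun=> 'C(n ^ k - (k * n.-1).+1, n ^ (k - 1)))) => [|y _].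
  by rewrite sum_nat_const card_ffun !card_ord.
rewrite -big_mkcondr /= sum1dep_card.
have -> : (n ^ k - (k * n.-1).+1)%N = #|~: deadly_spaces y|.
  by rewrite cardsCs finset.setCK card_deadly_spaces card_ffun !card_ord.
rewrite -cards_draws; apply: eq_card => B.
by rewrite !inE -mem_safe_spaces inE andbC.
Qed.

Lemma expected_safe_proportionE (R : realType) (k n : nat) : (0 < n)%N ->
  expected_safe_proportion R k n =
  'C(n ^ k - (k * n.-1).+1, n ^ (k - 1))%:R / 'C(n ^ k, n ^ (k - 1))%:R.
Proof.
move=> n_gt0; rewrite /expected_safe_proportion /uniform_expectation.
rewrite -natr_sum sum_card_safe_spaces /boards card_draws card_ffun !card_ord.
rewrite natrM mulrAC; congr (_ / _); rewrite mulrC mulKf //.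
by rewrite pnatr_eq0 -lt0n expn_gt0 n_gt0.
Qed.

(** Multiplying both binomials by [m!] gives falling factorials. If [N - a < m], both sides are 0,
    the factor at [i = N - a] being 0. *)
Lemma bin_ratio_prod (R : numFieldType) (N a m : nat) : (m <= N)%N ->
  'C(N - a, m)%:R / 'C(N, m)%:R = \prod_(i < m) ((N - a - i)%:R / (N - i)%:R) :> R.
Proof.
move=> mN; rewrite prodf_div -!natr_prod -!ffact_prod -!bin_ffact !natrM.
by rewrite -mulf_div divff ?mulr1 // pnatr_eq0 -lt0n fact_gt0.
Qed.

Lemma bin_ratio_le (R : realType) (N a m : nat) : (a + m < N)%N ->
  'C(N - a, m)%:R / 'C(N, m)%:R <= expR (- (a%:R * m%:R / N%:R)) :> R.
Proof.
move=> amN; rewrite bin_ratio_prod; last by lia.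
have -> : - (a%:R * m%:R / N%:R) = - (a%:R / N%:R) *+ m :> R.
  by rewrite -[RHS]mulr_natr mulNr mulrAC.
rewrite -[X in _ <= expR (_ *+ X)]card_ord -sumr_const expR_sum.
(* Factorwise, [1 - a/(N - i) <= 1 - a/N <= expR (- (a/N))]. *)
apply: ler_prod => i _; have im := ltn_ord i.
rewrite divr_ge0 //=; apply: le_trans (expR_ge1Dx _).
have N0 : 0 < N%:R :> R by rewrite ltr0n; lia.
have Ni0 : 0 < (N - i)%:R :> R by rewrite ltr0n; lia.
rewrite ler_pdivrMr // subnAC natrB; last by lia.
have -> : (1 + - (a%:R / N%:R)) * (N - i)%:R
   = (N - i)%:R - a%:R * ((N - i)%:R / N%:R) :> R by ring.
rewrite lerD2l lerN2 ler_piMr // ler_pdivrMr // mul1r ler_nat; lia.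
Qed.

Lemma bin_ratio_ge (R : realType) (N a m : nat) : (a + m < N)%N ->
  expR (- (a%:R * m%:R / (N - a - m)%:R)) <= 'C(N - a, m)%:R / 'C(N, m)%:R :> R.
Proof.
move=> amN; rewrite bin_ratio_prod; last by lia.
have -> : - (a%:R * m%:R / (N - a - m)%:R) = - (a%:R / (N - a - m)%:R) *+ m :> R.
  by rewrite -[RHS]mulr_natr mulNr mulrAC.
rewrite -[X in expR (_ *+ X) <= _]card_ord -sumr_const expR_sum.
apply: ler_prod => i _; have im := ltn_ord i.
(* Inverting turns the lower bound into an upper one: the inverse factor is [1 + a/(N - a - i)], at
   most [1 + a/(N - a - m)], and [1 + x <= expR x] applies again. *)
rewrite expR_ge0 /= expRN -[leRHS]invf_div lef_pV2 ?posrE ?expR_gt0 //; last first.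
  by rewrite divr_gt0 // ltr0n; lia.
apply: le_trans (expR_ge1Dx _).
have Ni0 : 0 < (N - a - i)%:R :> R by rewrite ltr0n; lia.
have -> : (N - i)%N = (N - a - i + a)%N by lia.
rewrite natrD mulrDl divff ?gt_eqF // lerD2l.
rewrite ler_wpM2l // lef_pV2 ?posrE ?ltr0n ?ler_nat; lia.
Qed.

(** The last bound is where [k >= 2] enters: then [n ^ (k - 1) >= n], while the deadly count is at
    most [k * n]. *)
Lemma deadly_count_bounds (k n : nat) : (2 <= k)%N -> (k.+2 <= n)%N ->
  [/\ (0 < n ^ (k - 1))%N, (n ^ k = n * n ^ (k - 1))%N &
      ((k * n.-1).+1 <= k * n ^ (k - 1))%N].
Proof.
move=> k2 kn; have n_gt0 : (0 < n)%N by lia.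
rewrite expn_gt0 n_gt0; split=> //; first by rewrite -expnS; congr expn; lia.
have -> : (k - 1 = (k - 2).+1)%N by lia.
rewrite expnS; have : (0 < n ^ (k - 2))%N by rewrite expn_gt0 n_gt0.
by move: (n ^ (k - 2))%N => q q_gt0; nia.
Qed.

Lemma expected_safe_proportion_le (R : realType) (k n : nat) :
  (2 <= k)%N -> (k.+2 <= n)%N ->
  expected_safe_proportion R k n <= expR (- k%:R + k%:R * n%:R^-1).
Proof.
move=> k2 kn; rewrite expected_safe_proportionE; last by lia.
have [] := deadly_count_bounds _ _ k2 kn.
move: (n ^ (k - 1))%N (n ^ k)%N => m N m_gt0 -> am.
apply: le_trans (bin_ratio_le _ _ _ _ _) _; first by nia.
have n0 : n%:R != 0 :> R by rewrite pnatr_eq0; lia.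
have m0 : m%:R != 0 :> R by rewrite pnatr_eq0; lia.
(* As [N = n * m], the exponent [a m / N] is just [a / n], and [a >= k (n - 1)]. *)
rewrite ler_expR natrM -mulf_div divff // mulr1.
have -> : - k%:R + k%:R / n%:R = - ((k * n.-1)%:R / n%:R) :> R.
  rewrite natrM -subn1 natrB; last by lia.
  by field.
by rewrite lerN2 ler_wpM2r ?invr_ge0 // ler_nat.
Qed.

(** From [a <= k n] and [N - a - m >= (n - k - 1) m], the exponent [a m / (N - a - m)] is at most
    [k n / (n - k - 1)], which exceeds [k] by [O(1/n)]. *)
Lemma expected_safe_proportion_ge (R : realType) (k n : nat) :
  (2 <= k)%N -> (k.+2 <= n)%N ->
  expR (- k%:R - (k * k.+1 * k.+2)%:R * n%:R^-1) <= expected_safe_proportion R k n.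
Proof.
move=> k2 kn; rewrite expected_safe_proportionE; last by lia.
have [] := deadly_count_bounds _ _ k2 kn.
have : ((k * n.-1).+1 <= k * n)%N by nia.
move: (n ^ (k - 1))%N (n ^ k)%N (k * n.-1).+1 => m N a akn m_gt0 -> akm.
have amN : (a + m < n * m)%N by nia.
apply: le_trans (bin_ratio_ge _ _ _ _ amN).
have n0 : 0 < n%:R :> R by rewrite ltr0n; lia.
rewrite ler_expR -opprD lerN2 ler_pdivrMr; last by rewrite ltr0n; lia.
have -> : k%:R + (k * k.+1 * k.+2)%:R / n%:R
   = (k * n + k * k.+1 * k.+2)%:R / n%:R :> R.
  by rewrite natrD mulrDl (natrM _ k n) mulfK ?gt_eqF.
rewrite mulrAC ler_pdivlMr // -!natrM ler_nat.
have rest : ((n - k.+1) * m <= n * m - a - m)%N by nia.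
(* The constant [(k+1)(k+2)] makes the right side minus the left equal to [(k+1)^2 (n - k - 2)],
   nonnegative exactly when [n >= k + 2]. *)
have quad : (n * n <= (n + k.+1 * k.+2) * (n - k.+1))%N.
  have -> : n = (n - k.+2 + k.+2)%N by lia.
  by move: (n - k.+2)%N => d; rewrite -addnBA //; nia.
apply: (@leq_trans (k * m * (n * n))).
  have -> : (k * m * (n * n) = k * n * m * n)%N by ring.
  by rewrite !leq_mul2r akn !orbT.
apply: (@leq_trans (k * m * ((n + k.+1 * k.+2) * (n - k.+1)))).
  by rewrite leq_mul2l quad orbT.
have -> : (k * m * ((n + k.+1 * k.+2) * (n - k.+1)) =
  (k * n + k * k.+1 * k.+2) * ((n - k.+1) * m))%N by ring.
by rewrite leq_mul2l rest orbT.
Qed.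

Local Open Scope classical_set_scope.
Local Open Scope ring_scope.

Theorem mainTheorem5 (R : realType) (k : nat) (hk : (2 <= k)%N) :
  expected_safe_proportion R k n @[n --> \oo] --> (1 / expR 1 ^+ k : R).
Proof.
have invn0 : (n%:R^-1 : R) @[n --> \oo] --> (0 : R).
  (* The harmonic sequence is [1/(n+1)], hence the shift by one. *)
  rewrite -cvg_shiftS; exact: cvg_harmonic.
have -> : 1 / expR 1 ^+ k = expR (- k%:R) :> R.
  by rewrite div1r -expRM_natl mulr1 expRN.
have lim c : expR (- k%:R + c * n%:R^-1) @[n --> \oo] --> (expR (- k%:R) : R).
  apply: continuous_cvg; first exact: continuous_expR.
  rewrite -[X in _ --> X]addr0 -[X in _ --> _ + X](mulr0 c).
  by apply: cvgD; [exact: cvg_cst | apply: cvgMr].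
apply: (squeeze_cvgr _ (lim (- (k * k.+1 * k.+2)%:R)) (lim k%:R)).
exists k.+2 => // n /= kn; rewrite mulNr.
by rewrite expected_safe_proportion_ge // expected_safe_proportion_le.
Qed.
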